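(* Let $p$ be a prime with $p\equiv3\pmod 4$, let $m$ be an odd positive integer and $s$ a positive integer. Then the negacyclic codes over $\mathbb{F}_{p^m}$ of length $2p^s$ are of the form $C[i]=\langle(x^2+1)^i\rangle$, where $0\le i\le p^s$, and $$d_H(C[i])=\begin{cases}2,&\text{if }1\le i\le p^{s-1},\\ \beta+2,&\text{if }\beta p^{s-1}+1\le i\le(\beta+1)p^{s-1},\ \text{where }1\le\beta\le p-2,\\ (\tau+1)p^k,&\text{if }p^s-p^{s-k}+(\tau-1)p^{s-k-1}+1\le i\le p^s-p^{s-k}+\tau p^{s-k-1},\\ &\text{where }1\le\tau\le p-1\text{ and }1\le k\le s-1.\end{cases}$$
   Context: The negacyclic codes of length $N$ over $\mathbb{F}_{p^m}$ are the ideals of $\mathbb{F}_{p^m}[x]/\langle x^N+1\rangle$, codewords being identified with polynomials of degree less than $N$. The Hamming weight $w_H$ is the number of nonzero coefficients, and $d_H(C)=\min\{w_H(c):0\ne c\in C\}$. *)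

(* Defs.v *)
From mathcomp Require Import all_boot all_order all_algebra.

Set Implicit Arguments.
Unset Strict Implicit.
Unset Printing Implicit Defensive.

Import GRing.Theory.
Local Open Scope ring_scope.

(* The ring F[x]/<x^N + 1>.  Its elements are the polynomials of degree < N;
   this needs N > 0, as {poly %/ h} silently replaces h by 'X when h is not
   monic of positive degree. *)
Notation negacyclic_ring F N := {poly %/ ('X^N + 1 : {poly F})}.

Section NegacyclicCodes.

Variables (F : finFieldType) (N : nat).
Local Notation A := (negacyclic_ring F N).

(* Unlike MathComp's idealr_closed, this does not exclude the unit ideal. *)
Definition negacyclic_code (C : {set A}) : Prop :=
  [/\ 0 \in C,
      forall u v, u \in C -> v \in C -> u + v \in C
    & forall a u, u \in C -> a * u \in C].

Definition principal_code (g : A) : {set A} := [set a * g | a : A].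

Definition wH (c : A) : nat := #|[set j : 'I_N | (c : {poly F})`_j != 0]|.

(* d = d_H(C).  It holds for no d when C is the zero code, where the minimum
   is over the empty set. *)
Definition is_dH (C : {set A}) (d : nat) : Prop :=
  (exists2 c, c \in C & c != 0 /\ wH c = d) /\
  (forall c, c \in C -> c != 0 -> (d <= wH c)%N).

End NegacyclicCodes.

(* The ideal generated by (x^2 + 1)^i in F[x]/<x^N + 1>. *)
Definition code_pow (F : finFieldType) (N i : nat) :
    {set negacyclic_ring F N} :=
  principal_code (('qX ^+ 2 + 1) ^+ i).

(* Main.v *)
Require Import Defs.
From mathcomp Require Import all_boot all_order all_fingroup all_algebra.
From mathcomp Require Import all_solvable all_field zify.

(** Write q = p ^ s and P = X^2 + 1.  In characteristic p the modulus
    X^(2q) + 1 is P ^ q.  Since p ^ m = 3 mod 4, the field has no square root of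
    -1, so P is irreducible and every ideal of F[x]/<P ^ q> is generated by a
    power of P ([negacyclic_code_pow]): the least power of P lying in the ideal
    works, by Bezout.

    For the distance, a polynomial splits as f = a(X^2) + X b(X^2), the weight
    of f is the sum of the weights of a and b, and P ^ i divides f exactly when
    (X + 1) ^ i divides both a and b.  Hence it is enough to bound from below the
    weight of a nonzero polynomial that vanishes at -1 to order at least i and
    has degree less than q.  This rests on a bound due to Massey, Costello and
    Justesen ([digprod_wt]): a polynomial vanishing to order exactly e at some
    c <> 0 has weight at least the product of (d + 1) over the base-p digits d
    of e.  It is proved one digit at a time, now splitting f according to the
    exponents modulo p.  If e = p e' + d with d < p, then (X^p - c^p) ^ e' factors
    out of every part; reducing the cofactor modulo X^p - c^p = (X - c) ^ p leaves
    a nonzero polynomial of degree less than p which vanishes to order at least d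
    at c, and so has at least d + 1 nonzero coefficients ([ltn_wt_small]).  Each
    of these designates a part of f whose order of vanishing at c^p is exactly
    e', and induction applies to that part.

    What remains is to minimise the digit product over the interval i <= e < q
    ([digprod_ge]).  The three ranges of the theorem are one family: the
    first two are the case k = 0, with tau = 1 and tau = beta + 1.  In all of
    them the least weight is (tau + 1) p ^ k, and P ^ j has it for the right end j
    of the range, since j = (p ^ k - 1) p ^ (a + 1) + tau p ^ a with
    a = s - k - 1 makes P ^ j a product of powers of two binomials
    ([is_dH_code_pow]). *)

Set Implicit Arguments.
Unset Strict Implicit.
Unset Printing Implicit Defensive.

(** * Products of incremented base-p digits *)

Section DigitProduct.

Variable p : nat.
Hypothesis p_gt1 : 1 < p.

(** The number of binomial coefficients 'C(e, _) prime to p when e < p ^ s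
    (Lucas), that is, the weight of (X + 1) ^ e in characteristic p. *)
Fixpoint digprod (s e : nat) : nat :=
  if s is s'.+1 then (e %% p).+1 * digprod s' (e %/ p) else 1.

Lemma digprod_gt0 s e : 0 < digprod s e.
Proof. by elim: s e => //= s IHs e; rewrite muln_gt0 IHs. Qed.

Lemma digprod_gt1 s e : 0 < e < p ^ s -> 1 < digprod s e.
Proof.
elim: s e => [|s IHs] e /= /andP[e_gt0 lt_e]; first by case: e e_gt0 lt_e.
have [e0|e0] := posnP (e %% p); last first.
  by rewrite (leq_trans _ (leq_pmulr _ (digprod_gt0 _ _))).
rewrite e0 mul1n IHs // divn_gt0 ?(ltnW p_gt1) // dvdn_leq //=; last first.
  by rewrite /dvdn e0.
by rewrite ltn_divLR ?(ltnW p_gt1) // -expnSr.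
Qed.

Lemma digprodD a b e :
  digprod (a + b) e = digprod a (e %% p ^ a) * digprod b (e %/ p ^ a).
Proof.
elim: a e => [|a IHa] e /=; first by rewrite mul1n divn1.
rewrite IHa mulnA expnS -divnMA modn_dvdm ?dvdn_mulr //.
by rewrite modn_divl (mulnC (p ^ a)).
Qed.

Lemma digprod_max s : digprod s (p ^ s).-1 = p ^ s.
Proof.
elim: s => //= s IHs.
have ps_gt0 : 0 < p ^ s by rewrite expn_gt0 (ltnW p_gt1).
have -> : (p ^ s.+1).-1 = (p ^ s).-1 * p + p.-1 by rewrite expnS; nia.
have lt_p : p.-1 < p by lia.
by rewrite divnMDl ?modnMDl ?modn_small ?divn_small ?addn0 ?IHs ?expnS; lia.
Qed.

(** The top k digits of e are p - 1.  The next one is at least t, which gives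
    the bound at once, or it is t - 1; then the digits below it are not all
    zero, and their product, at least 2, compensates as 2 t >= t + 1. *)
Lemma digprod_ge s k t e :
    0 < t -> k < s ->
    p ^ s - p ^ (s - k) + (t - 1) * p ^ (s - k - 1) < e < p ^ s ->
  (t + 1) * p ^ k <= digprod s e.
Proof.
move=> t_gt0 lt_ks.
have [a ->] : exists a, s = (a + k.+1)%N by exists (s - k.+1); lia.
have -> : a + k.+1 - k = a.+1 by lia.
rewrite subSS subn0 => /andP[lt_e lt_es].
have pa_gt0 : 0 < p ^ a by rewrite expn_gt0 (ltnW p_gt1).
have pk_gt0 : 0 < p ^ k by rewrite expn_gt0 (ltnW p_gt1).
rewrite digprodD; move: (divn_eq e (p ^ a)) (ltn_pmod e pa_gt0).
set r := e %% _; set E := e %/ _ => def_e lt_r.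
have ltE : E < p ^ k.+1 by rewrite ltn_divLR // -expnD addnC.
set D := (p ^ k).-1 * p + (t - 1).
have eqD : p ^ (a + k.+1) - p ^ a.+1 + (t - 1) * p ^ a = D * p ^ a.
  by rewrite expnD !expnS /D -{2}[p ^ k]prednK //; nia.
rewrite {}eqD def_e in lt_e.
have leDE : D <= E by rewrite -ltnS -(ltn_pmul2r pa_gt0); nia.
have div_p : E %/ p = (p ^ k).-1.
  apply/eqP; rewrite eqn_leq; apply/andP; split.
    by rewrite -ltnS prednK // ltn_divLR ?(ltnW p_gt1) // -expnSr.
  by rewrite leq_divRL ?(ltnW p_gt1) //; lia.
rewrite [digprod k.+1 _]/= div_p digprod_max mulnA leq_mul2r.
apply/orP; right; move: (divn_eq E p); rewrite div_p => def_E.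
have [lt_DE|] := ltnP D E.
  by rewrite -[_ + 1]mul1n leq_mul ?digprod_gt0 //; lia.
move=> leED; have r_gt0 : 0 < r by nia.
have : 1 < digprod a r by rewrite digprod_gt1 // r_gt0 lt_r.
have -> : E %% p = t - 1 by lia.
nia.
Qed.

End DigitProduct.

(** * Weights of polynomials *)

Section Weight.

Import GRing.Theory.
Local Open Scope ring_scope.

Variable R : idomainType.
Implicit Types f g : {poly R}.

Definition wt f : nat := count (fun a => a != 0) f.

Lemma wtE n f : (size f <= n)%N -> wt f = (\sum_(i < n) (f`_i != 0)%R)%N.
Proof.
move=> le_n; rewrite -(big_mkord xpredT (fun i => (f`_i != 0) : nat)).
rewrite (big_cat_nat (leq0n _) le_n) /=.
rewrite [X in (_ + X)%N]big_nat [X in (_ + X)%N]big1 ?addn0; last first.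
  by move=> i /andP[le_i _]; rewrite nth_default ?eqxx.
by rewrite /wt -sum1_count (big_nth 0) big_mkcond.
Qed.

Lemma wt_gt0 f : (0 < wt f)%N = (f != 0).
Proof.
rewrite /wt -has_count; apply/idP/idP => [/hasP[a]|nz_f].
  by move=> f_a _; apply: contraTneq f_a => ->; rewrite polyseq0.
apply/hasP; exists (lead_coef f); last by rewrite lead_coef_eq0.
by rewrite mem_nth // prednK // size_poly_gt0.
Qed.

Lemma leq_wtD f g : (wt (f + g) <= wt f + wt g)%N.
Proof.
have [le_f le_g] := (leq_maxl (size f) (size g), leq_maxr (size f) (size g)).
rewrite (wtE (size_polyD f g)) (wtE le_f) (wtE le_g) -big_split /=.
apply: leq_sum => i _; rewrite coefD.
by have [->|_] := eqVneq f`_i 0; [rewrite add0r | case: (_ == 0)].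
Qed.

Lemma leq_wt_sum I (r : seq I) (F : I -> {poly R}) :
  (wt (\sum_(i <- r) F i) <= \sum_(i <- r) wt (F i))%N.
Proof.
elim/big_rec2: _ => [|i m f _ le_f]; first by rewrite /wt polyseq0.
by rewrite (leq_trans (leq_wtD _ _)) // leq_add2l.
Qed.

Lemma wtMX f : wt (f * 'X) = wt f.
Proof.
have [->|nz_f] := eqVneq f 0; first by rewrite mul0r.
by rewrite /wt polyseqMX //= eqxx.
Qed.

Lemma wtMXn f n : wt (f * 'X^n) = wt f.
Proof. by elim: n => [|n IHn]; rewrite ?mulr1 // exprSr mulrA wtMX. Qed.

Lemma leq_wtZ a f : (wt (a *: f) <= (a != 0)%R * wt f)%N.
Proof.
have [->|nz_a] := eqVneq a 0; first by rewrite scale0r /wt polyseq0.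
rewrite mul1n (wtE (size_scale_leq a f)) (wtE (leqnn (size f))).
by apply: leq_sum => i _; rewrite coefZ mulf_eq0 (negPf nz_a).
Qed.

Lemma leq_wtM f g : (wt (f * g) <= wt f * wt g)%N.
Proof.
rewrite -{1}[f]coefK poly_def big_distrl /= (leq_trans (leq_wt_sum _ _)) //.
rewrite (wtE (leqnn (size f))) big_distrl /=; apply: leq_sum => i _.
by rewrite -scalerAl mulrC (leq_trans (leq_wtZ _ _)) ?wtMXn.
Qed.

Lemma leq_wt_Xn1X n r : (wt (('X^n + 1) ^+ r) <= r.+1)%N.
Proof.
rewrite exprD1n (leq_trans (leq_wt_sum _ _)) //.
rewrite -[X in (_ <= X)%N]card_ord -sum1_card leq_sum // => i _.
rewrite -exprM -scaler_nat (leq_trans (leq_wtZ _ _)) //.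
by rewrite -['X^_]mul1r wtMXn /wt polyseq1 /= oner_eq0 addn0 muln1 leq_b1.
Qed.

(** * Splitting a polynomial by exponents modulo n *)

Definition sect n r f : {poly R} := \poly_(j < size f) f`_(j * n + r).

Lemma coef_sect n r f j : (0 < n)%N -> (sect n r f)`_j = f`_(j * n + r).
Proof.
move=> n_gt0; rewrite coef_poly; case: ltnP => // le_j.
rewrite nth_default // (leq_trans le_j) //.
by rewrite (leq_trans (leq_pmulr _ n_gt0)) ?leq_addr.
Qed.

Lemma sum_ord_mul (N n : nat) (F : nat -> nat) :
  (\sum_(i < N * n) F i = \sum_(r < n) \sum_(j < N) F (j * n + r))%N.
Proof.
rewrite -(big_mkord xpredT F) big_nat_mul big_mkord exchange_big /=.
apply: eq_bigr => j _; rewrite mulSn addnC.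
rewrite -{1}[(j * n)%N]add0n big_addn addKn big_mkord.
by under eq_bigr do rewrite addnC.
Qed.

Lemma wt_sect n f : (0 < n)%N -> wt f = (\sum_(r < n) wt (sect n r f))%N.
Proof.
move=> n_gt0; rewrite (@wtE (size f * n)) ?leq_pmulr //.
rewrite (sum_ord_mul _ _ (fun i => f`_i != 0 : nat)); apply: eq_bigr => r _.
rewrite (@wtE (size f)) ?size_poly //.
by apply: eq_bigr => j _; rewrite coef_sect.
Qed.

Lemma size_sect n r f m :
  (0 < n)%N -> (size f <= m * n)%N -> (size (sect n r f) <= m)%N.
Proof.
move=> n_gt0 le_f; apply/leq_sizeP => j le_j; rewrite coef_sect //.
rewrite nth_default // (leq_trans le_f) // (leq_trans _ (leq_addr _ _)) //.
by rewrite leq_mul2r le_j orbT.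
Qed.

Lemma sectE n f : (0 < n)%N -> f = \sum_(r < n) 'X^r * (sect n r f \Po 'X^n).
Proof.
move=> n_gt0; apply/polyP => k; rewrite coef_sum.
rewrite (bigD1 (Ordinal (ltn_pmod k n_gt0))) //= big1 ?addr0 => [|r ne_r].
  rewrite coefXnM ltnNge leq_mod /= coef_comp_poly_Xn //.
  have -> : (k - k %% n = k %/ n * n)%N by rewrite {1}(divn_eq k n) addnK.
  by rewrite dvdn_mull // mulnK // coef_sect // -divn_eq.
rewrite coefXnM; case: ltnP => // le_r; rewrite coef_comp_poly_Xn //.
case: ifP => // /dvdnP[q def_k]; case/eqP: ne_r; apply: val_inj => /=.
by rewrite -(subnK le_r) def_k modnMDl modn_small.
Qed.

(** F[X] is a free module over F[X^n], with basis the X^r for r < n; taking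
    coordinates is linear over F[X^n]. *)
Lemma sect_comp_mul n q r f : (r < n)%N ->
  sect n r ((q \Po 'X^n) * f) = q * sect n r f.
Proof.
move=> lt_rn; have n_gt0 : (0 < n)%N := leq_ltn_trans (leq0n r) lt_rn.
elim/poly_ind: q => [|q c IHq].
  by rewrite comp_poly0 !mul0r; apply/polyP=> j; rewrite coef_sect ?coef0.
rewrite comp_polyD comp_polyM comp_polyX comp_polyC mulrDl [RHS]mulrDl.
rewrite [q * 'X]mulrC -['X * q * _]mulrA -IHq; apply/polyP => j.
rewrite coefD coefCM coefXM !coef_sect // coefD coefCM mulrAC coefMXn.
congr (_ + _); case: j => [|j] /=; first by rewrite add0n lt_rn.
by rewrite mulSn -addnA ltnNge leq_addr addKn.
Qed.

End Weight.

(** * Weight and order of vanishing in characteristic p *)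

Section CharP.

Import GRing.Theory.
Local Open Scope ring_scope.

Variables (K : fieldType) (p : nat).
Hypothesis pcharKp : p \in [pchar K].
Implicit Types (f g : {poly K}) (c : K).

Lemma deriv_eq0_small f : (size f <= p)%N -> f^`() = 0 -> (size f <= 1)%N.
Proof.
move=> le_p df0; apply/leq_sizeP => -[|i] // _.
have [le_f|lt_f] := leqP (size f) i.+1; first by rewrite nth_default.
apply/eqP; have := coef_deriv f i; rewrite df0 coef0 => /esym/eqP.
rewrite -mulr_natr mulf_eq0 -(dvdn_pcharf pcharKp) => /orP[//|/dvdn_leq].
by move/(_ isT); rewrite leqNgt (leq_trans lt_f).
Qed.

Lemma wt_deriv f : f`_0 != 0 -> (wt f^`() < wt f)%N.
Proof.
move=> nz_f0; case def_n: (size f) => [|n].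
  by rewrite nth_default ?def_n ?eqxx in nz_f0.
have le_df: (size f^`() <= n)%N.
  by rewrite -ltnS -def_n lt_size_deriv // -size_poly_gt0 def_n.
rewrite (@wtE _ n.+1 f) ?def_n // (@wtE _ n) // big_ord_recl nz_f0 ltnS.
rewrite leq_sum // => i _; rewrite coef_deriv lift0.
have [->|//] := eqVneq f`_i.+1 0; first by rewrite mul0rn eqxx.
by rewrite leq_b1.
Qed.

(** The argument behind Descartes' rule of signs: up to division by a power of
    X, which does not vanish at c, the constant coefficient is nonzero, and
    differentiating lowers the weight by at least one and the order of
    vanishing by at most one.  In degree less than p only constants have a
    zero derivative. *)
Lemma ltn_wt_small f c e : c != 0 -> f != 0 -> (size f <= p)%N ->
  ('X - c%:P) ^+ e %| f -> (e < wt f)%N.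
Proof.
move=> nz_c; have [n] := ubnP (size f).
elim: n f e => // n IHn f e lt_n nz_f le_p.
have [/eqP f0|nz_f0] := eqVneq f`_0 0.
  have /factor_theorem[g] : root f 0 by rewrite rootE horner_coef0.
  rewrite subr0 => def_f; move: lt_n nz_f le_p.
  rewrite def_f mulf_eq0 polyX_eq0 orbF => lt_n nz_g le_p.
  rewrite size_mulX // in lt_n le_p.
  rewrite wtMX Gauss_dvdpl => [|]; first exact: IHn _ _ lt_n nz_g (ltnW le_p).
  by rewrite coprimep_expl // coprimepX rootE !hornerE oppr_eq0.
case: e => [|e] dv_f; first by rewrite wt_gt0.
apply: leq_trans (wt_deriv nz_f0); rewrite ltnS.
have lt_df := lt_size_deriv nz_f.
apply: IHn; first exact: leq_trans lt_df _.
- apply/eqP => /(deriv_eq0_small le_p)/size1_polyC def_f.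
  move: dv_f; rewrite def_f exprS => /(dvdp_trans (dvdp_mulr _ (dvdpp _))).
  by rewrite dvdp_XsubCl rootE hornerC (negPf nz_f0).
- exact: leq_trans (ltnW lt_df) le_p.
have /dvdpP[g ->] := dv_f.
rewrite derivM deriv_exp /= dvdp_add ?dvdp_mull //.
  by rewrite exprS dvdp_mull.
by rewrite -mulr_natr dvdp_mulr // dvdp_mull.
Qed.

Lemma exprXsubC_pchar c : ('X - c%:P) ^+ p = 'X^p - (c ^+ p)%:P.
Proof.
have pcharP : p \in [pchar {poly K}] by rewrite pchar_poly.
have p_nat : [pchar {poly K}].-nat p by rewrite pnatE ?(pcharf_prime pcharKp).
by rewrite exprDn_pchar // exprNn_pchar // -polyC_exp.
Qed.

(** The induction peels off the lowest digit of e and replaces c by c ^+ p.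
    Keeping only the s lowest digits spares any bound on degrees: when s = 0
    the claim is that the polynomial is nonzero. *)
Lemma digprod_wt s e c g : c != 0 -> ~~ root g c ->
  (digprod p s e <= wt (('X - c%:P) ^+ e * g))%N.
Proof.
elim: s e c g => [|s IHs] e c g nz_c ng_c.
  rewrite wt_gt0 mulf_neq0 ?expf_neq0 ?polyXsubC_eq0 //.
  by apply: contraNneq ng_c => ->; rewrite root0.
have p_gt0 : (0 < p)%N by rewrite prime_gt0 // (pcharf_prime pcharKp).
set a := c ^+ p; set u := ('X - c%:P) ^+ (e %% p) * g.
have XaE : ('X - a%:P) \Po 'X^p = ('X - c%:P) ^+ p.
  by rewrite comp_polyB comp_polyX comp_polyC exprXsubC_pchar.
have -> : ('X - c%:P) ^+ e * g = (('X - a%:P) ^+ (e %/ p) \Po 'X^p) * u.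
  by rewrite rmorphXn /= XaE -exprM mulrA -exprD mulnC -divn_eq.
(* h is the remainder of u modulo X^p - a: its coefficients are the values at
   a of the parts of u. *)
pose h := \poly_(r < p) (sect p r u).[a].
have dv_uh : ('X - c%:P) ^+ p %| u - h.
  rewrite {1}(sectE u p_gt0) /h poly_def -sumrB.
  elim/big_rec: _ => [|r q _ dv_q]; first exact: dvdp0.
  rewrite dvdp_add // -mul_polyC mulrC -mulrBl dvdp_mulr // -XaE.
  set v := sect _ _ _; rewrite -[v.[a]%:P](comp_polyC _ 'X^p) -comp_polyB.
  by apply: dvdp_comp_poly; rewrite dvdp_XsubCl rootE !hornerE subrr.
have lt_e : (e %% p < p)%N by rewrite ltn_pmod.
have nz_h : h != 0.
  apply: contraNneq ng_c => h0; move: dv_uh; rewrite h0 subr0 /u.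
  rewrite -{1}(subnKC (ltnW lt_e)) exprD.
  rewrite dvdp_mul2l ?expf_neq0 ?polyXsubC_eq0 //.
  rewrite -[(p - _)%N]prednK ?subn_gt0 // exprS.
  by move/(dvdp_trans (dvdp_mulr _ (dvdpp _))); rewrite dvdp_XsubCl.
have dv_h : ('X - c%:P) ^+ (e %% p) %| h.
  rewrite -[h](subKr u) dvdp_sub ?dvdp_mulr // (dvdp_trans _ dv_uh) //.
  by rewrite dvdp_exp2l // ltnW.
have le_h : (size h <= p)%N := size_poly _ _.
have lt_h := ltn_wt_small nz_c nz_h le_h dv_h.
rewrite /= (leq_trans (leq_mul lt_h (leqnn _))) //.
rewrite (wtE le_h) (@wt_sect _ p) // big_distrl leq_sum // => r _.
rewrite coef_poly ltn_ord sect_comp_mul //.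
have [_|nz_r] := eqVneq (sect p r u).[a] 0.
  by rewrite [X in (X <= _)%N]mul0n.
by rewrite [X in (X <= _)%N]mul1n IHs ?expf_neq0 // rootE.
Qed.

End CharP.

(** * Negacyclic codes as ideals of F[x]/<(x^2+1)^q> *)

Section NegacyclicRing.

Import GRing.Theory.
Local Open Scope ring_scope.

(** A square root of -1 has fourth power 1, hence the power of exponent
    #|F| - 1 = 2 mod 4 of it is -1.  It is also 1, so that F has
    characteristic 2, which contradicts the parity of #|F|. *)
Lemma irreducible_X2add1 (F : finFieldType) :
  (#|F| %% 4 = 3)%N -> irreducible_poly ('X^2 + 1 : {poly F}).
Proof.
move=> cardF; apply: cubic_irreducible => [|a]; first by rewrite size_XnaddC.
apply/negP; rewrite rootE !hornerE => /eqP a2E.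
have {}a2E : a ^+ 2 = -1 by apply/eqP; rewrite -addr_eq0 a2E.
have nz_a : a != 0.
  apply/eqP => a0; move/eqP: a2E.
  by rewrite a0 expr0n /= eq_sym oppr_eq0 oner_eq0.
have [n def_n] : exists n, #|F| = (4 * n + 3)%N.
  by exists (#|F| %/ 4)%N; rewrite {1}(divn_eq #|F| 4) cardF mulnC.
have := expf_card a.
rewrite def_n addnS exprS -[RHS]mulr1 => /(mulfI nz_a).
have -> : (4 * n + 2 = 2 * (2 * n).+1)%N by lia.
rewrite exprM a2E exprS exprM sqrrN !expr1n mulr1 => eqN1.
have order2 : #[1%R : F]%g = 2%N.
  apply: nt_prime_order => //; last exact: oner_neq0.
  by rewrite FinRing.zmodXgE mulr2n -{1}eqN1 addrC subrr.
have := order_dvdG (in_setT (1 : F)).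
by rewrite order2 cardsT def_n => /dvdnP[k]; lia.
Qed.

Variables (F : finFieldType) (N : nat).
Hypothesis N_gt0 : (0 < N)%N.
Local Notation h := ('X^N + 1 : {poly F}).
Local Notation A := (negacyclic_ring F N).
Local Notation P := ('X^2 + 1 : {poly F}).

Lemma mk_monic_negacyclic : mk_monic h = h.
Proof. by rewrite /mk_monic size_XnaddC // monicXnaddC // ltnS N_gt0. Qed.

Lemma size_negacyclic (c : A) : (size (c : {poly F}) <= N)%N.
Proof.
rewrite -ltnS (leq_trans (size_mk_monic c)) //.
by rewrite mk_monic_negacyclic size_XnaddC.
Qed.

Lemma in_qpolyE (f : {poly F}) : in_qpoly h f = f %% h :> {poly F}.
Proof.
by rewrite /= mk_monic_negacyclic Pdiv.IdomainMonic.modpE ?monicXnaddC.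
Qed.

Lemma in_qpoly_val (c : A) : in_qpoly h c = c.
Proof. exact/val_inj/in_qpoly_small/size_mk_monic. Qed.

Lemma in_qpoly_eq0 (f : {poly F}) : h %| f -> in_qpoly h f = 0.
Proof. by move=> dv_f; apply/val_inj/(etrans (in_qpolyE f))/modp_eq0. Qed.

Lemma wH_wt (c : A) : wH c = wt (c : {poly F}).
Proof. by rewrite (wtE (size_negacyclic c)) /wH -sum1dep_card big_mkcond. Qed.

Lemma code_powE i :
  code_pow F N i = principal_code (in_qpoly h (P ^+ i)).
Proof. by rewrite /code_pow rmorphXn rmorphD rmorphXn rmorph1. Qed.

Lemma code_pow_ideal i : negacyclic_code (code_pow F N i).
Proof.
split=> [|u v|a u]; first by apply/imsetP; exists 0; rewrite ?mul0r.
  move=> /imsetP[a _ ->] /imsetP[b _ ->]; rewrite -mulrDl.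
  by apply/imsetP; exists (a + b).
by move=> /imsetP[b _ ->]; rewrite mulrA; apply/imsetP; exists (a * b).
Qed.

Variable q : nat.
Hypothesis hE : h = P ^+ q.

Lemma mem_code_pow i (c : A) : (i <= q)%N ->
  (c \in code_pow F N i) = (P ^+ i %| (c : {poly F})).
Proof.
move=> le_iq; rewrite code_powE; apply/imsetP/dvdpP => [[a _ ->]|[w def_c]].
  apply/dvdpP; rewrite -[a]in_qpoly_val -in_qpolyM in_qpolyE.
  by rewrite -dvdp_mod ?dvdp_mull // hE dvdp_exp2l.
by exists (in_qpoly h w); rewrite // -in_qpolyM -def_c in_qpoly_val.
Qed.

Lemma split_pow (f : {poly F}) : irreducible_poly P -> f != 0 ->
  exists j g, f = g * P ^+ j /\ coprimep P g.
Proof.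
move=> irrP; have [n] := ubnP (size f); elim: n f => // n IHn f lt_n nz_f.
have [dv_f|ndv_f] := boolP (P %| f); last first.
  by exists 0, f; rewrite mulr1 irreducible_poly_coprime.
have /dvdpP[f1 def_f] := dv_f; move: nz_f lt_n; rewrite def_f mulf_eq0 negb_or.
case/andP=> nz_f1 nz_P.
rewrite size_mul // size_XnaddC // addn3 /= => /ltnW lt_n.
have [j [g [-> cop]]] := IHn f1 lt_n nz_f1.
by exists j.+1, g; rewrite [_ ^+ j.+1]exprSr mulrA.
Qed.

(** Let i be least such that P ^+ i is in C.  An element g * P ^+ j of C with g
    prime to P generates P ^+ j, as g is invertible modulo P ^+ q; hence i <= j
    and it is a multiple of P ^+ i. *)
Lemma negacyclic_code_pow (C : {set A}) : irreducible_poly P ->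
  negacyclic_code C -> exists2 i, (i <= q)%N & C = code_pow F N i.
Proof.
move=> irrP [C0 _ CM].
have exC : exists i, in_qpoly h (P ^+ i) \in C.
  by exists q; rewrite in_qpoly_eq0 // hE.
case: (ex_minnP exC) => i Ci min_i.
have le_iq : (i <= q)%N.
  by apply: min_i; rewrite in_qpoly_eq0 // hE.
exists i => //; apply/setP => c; apply/idP/idP => [Cc|]; last first.
  by rewrite code_powE => /imsetP[a _ ->]; apply: CM.
rewrite mem_code_pow //; have [->|nz_c] := eqVneq (c : {poly F}) 0.
  exact: dvdp0.
have [j [g [def_c cop]]] := split_pow irrP nz_c.
rewrite def_c dvdp_mull // dvdp_exp2l // min_i //.
have /Bezout_eq1_coprimepP[[u v] /= uv1] : coprimep g (P ^+ q).
  by rewrite coprimep_expr // coprimep_sym.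
suff -> : in_qpoly h (P ^+ j) = in_qpoly h u * c by apply: CM.
have Pj : P ^+ j = u * (g * P ^+ j) + v * P ^+ j * h.
  by rewrite hE mulrAC mulrA -mulrDl uv1 mul1r.
rewrite -[c]in_qpoly_val -in_qpolyM def_c {1}Pj in_qpolyD.
by rewrite (@in_qpoly_eq0 (v * P ^+ j * h)) ?addr0 // dvdp_mull.
Qed.

End NegacyclicRing.

(** * Minimum distance *)

Section Distance.

Import GRing.Theory.
Local Open Scope ring_scope.

Variables (p s : nat) (F : finFieldType).
Hypothesis p_pr : prime p.
Hypothesis pcharFp : p \in [pchar F].
Local Notation P := ('X^2 + 1 : {poly F}).
Local Notation h := ('X^(2 * p ^ s) + 1 : {poly F}).

Let p_gt1 : (1 < p)%N := prime_gt1 p_pr.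

Lemma X2add1_pchar b : P ^+ (p ^ b) = 'X^(2 * p ^ b) + 1.
Proof.
rewrite exprDn_pchar ?expr1n -?exprM // pnatX pnatE //.
by rewrite pchar_poly pcharFp.
Qed.

(** A nonzero part of f, by parity of exponents, is a multiple of (X + 1) ^ i of
    degree less than p ^ s, so its order of vanishing e at -1 satisfies
    i <= e < p ^ s, and the digit product of e bounds its weight. *)
Lemma leq_wt_mul_X2add1 i k t (f : {poly F}) :
    (0 < t)%N -> (k < s)%N ->
    (p ^ s - p ^ (s - k) + (t - 1) * p ^ (s - k - 1) < i)%N ->
    f != 0 -> (size f <= 2 * p ^ s)%N -> P ^+ i %| f ->
  ((t + 1) * p ^ k <= wt f)%N.
Proof.
move=> t_gt0 lt_ks lt_i nz_f le_f /dvdpP[w def_f].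
have [r nz_v] : exists r : 'I_2, sect 2 r f != 0.
  apply/existsP; apply: contraNT nz_f => /existsPn v0.
  rewrite (@sectE _ 2 f) // big1 // => r _.
  by rewrite (eqP (negbNE (v0 r))) comp_poly0 mulr0.
have := multiplicity_XsubC (sect 2 r f) (-1); rewrite nz_v.
case=> e [g] /= ng_g def_v.
have v_dv : ('X - (-1)%:P) ^+ i %| sect 2 r f.
  have XE : P = ('X - (-1)%:P) \Po 'X^2.
    by rewrite comp_polyB comp_polyX comp_polyC polyCN opprK.
  by rewrite def_f mulrC XE -rmorphXn /= sect_comp_mul // dvdp_mulr.
have le_ie : (i <= e)%N.
  rewrite leqNgt; apply: contra ng_g => lt_ei; move: v_dv; rewrite def_v.
  rewrite mulrC -{1}(subnKC (ltnW lt_ei)) exprD.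
  rewrite dvdp_mul2l ?expf_neq0 ?polyXsubC_eq0 //.
  rewrite -[(i - e)%N]prednK ?subn_gt0 // exprS.
  by move/(dvdp_trans (dvdp_mulr _ (dvdpp _))); rewrite dvdp_XsubCl.
have lt_e : (e < p ^ s)%N.
  apply: (@leq_trans (size (sect 2 r f))).
    have nz_g : g != 0 by apply: contraNneq ng_g => ->; rewrite root0.
    rewrite def_v size_Mmonic ?monic_exp ?monicXsubC // size_exp_XsubC addnS.
    by rewrite -[X in (X < _)%N]add0n ltn_add2r size_poly_gt0.
  by rewrite size_sect // mulnC.
rewrite (wt_sect f (isT : (0 < 2)%N)) (bigD1 r) //=.
apply: leq_trans (leq_addr _ _).
rewrite def_v mulrC; apply: leq_trans (digprod_wt pcharFp s e _ ng_g).
  by apply: digprod_ge => //; rewrite lt_e (leq_trans lt_i).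
by rewrite oppr_eq0 oner_eq0.
Qed.

(** The word of least weight is P ^+ j for the right end j of the range: by
    Frobenius it is the product of (X^(2 p^(a+1)) + 1) ^ (p^k - 1) and
    (X^(2 p^a) + 1) ^ t, which have at most p^k and t + 1 terms. *)
Lemma is_dH_code_pow i k t :
    (0 < t < p)%N -> (k < s)%N ->
    (p ^ s - p ^ (s - k) + (t - 1) * p ^ (s - k - 1) < i)%N ->
    (i <= p ^ s - p ^ (s - k) + t * p ^ (s - k - 1))%N ->
  is_dH (code_pow F (2 * p ^ s) i) ((t + 1) * p ^ k).
Proof.
case/andP=> t_gt0 lt_tp lt_ks lt_i.
set j := (X in (i <= X)%N) => le_ij.
have ps_gt0 : (0 < p ^ s)%N by rewrite expn_gt0 prime_gt0.
have N_gt0 : (0 < 2 * p ^ s)%N by rewrite muln_gt0.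
have hE : h = P ^+ (p ^ s) by rewrite X2add1_pchar.
have [a def_s] : exists a, s = (a + k.+1)%N by exists (s - k.+1)%N; lia.
have def_j : j = (p ^ a.+1 * (p ^ k).-1 + p ^ a * t)%N.
  rewrite /j def_s; have -> : (a + k.+1 - k = a.+1)%N by lia.
  rewrite subSS subn0 expnD !expnS.
  have : (0 < p ^ k)%N by rewrite expn_gt0 prime_gt0.
  case: (p ^ k)%N => // n _; nia.
have lt_j : (j < p ^ s)%N.
  rewrite def_j def_s expnD !expnS.
  have : (0 < p ^ k)%N by rewrite expn_gt0 prime_gt0.
  have : (0 < p ^ a)%N by rewrite expn_gt0 prime_gt0.
  case: (p ^ k)%N => // n pa_gt0 _; nia.
have le_is : (i <= p ^ s)%N by lia.
have size_Pj : (size (P ^+ j) <= 2 * p ^ s)%N.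
  apply: (leq_trans (size_poly_exp_leq _ _)).
  by rewrite size_XnaddC // ltn_mul2l.
have val_c : in_qpoly h (P ^+ j) = P ^+ j :> {poly F}.
  by rewrite in_qpoly_small // mk_monic_negacyclic // size_XnaddC.
have lower c : c \in code_pow F (2 * p ^ s) i -> c != 0 ->
    ((t + 1) * p ^ k <= wH c)%N.
  rewrite (mem_code_pow N_gt0 hE) // wH_wt // => dv_c nz_c.
  by apply: leq_wt_mul_X2add1 dv_c; rewrite ?size_negacyclic.
have nz_P : P != 0 by rewrite -size_poly_gt0 size_XnaddC.
have nz_c : in_qpoly h (P ^+ j) != 0.
  apply/eqP => /(congr1 val) /eqP.
  by rewrite [val _]val_c expf_eq0 (negPf nz_P) andbF.
have c_in : in_qpoly h (P ^+ j) \in code_pow F (2 * p ^ s) i.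
  by rewrite (mem_code_pow N_gt0 hE) // val_c dvdp_exp2l.
split=> //; exists (in_qpoly h (P ^+ j)) => //; split=> //.
apply/eqP; rewrite eqn_leq lower // andbT wH_wt // val_c def_j exprD !exprM.
rewrite !X2add1_pchar (leq_trans (leq_wtM _ _)) // mulnC leq_mul //.
  by rewrite addn1 leq_wt_Xn1X.
by rewrite -[X in (_ <= X)%N]prednK ?leq_wt_Xn1X // expn_gt0 prime_gt0.
Qed.

End Distance.

Theorem theorem7p10 (p m s : nat) (F : finFieldType) :
  prime p -> p = 3 %[mod 4] -> odd m -> 0 < s -> #|F| = p ^ m ->
  (forall C : {set negacyclic_ring F (2 * p ^ s)},
     negacyclic_code C <-> exists2 i, i <= p ^ s & C = code_pow F (2 * p ^ s) i)
  /\
  (forall i, i <= p ^ s ->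
    [/\ 1 <= i <= p ^ (s - 1) -> is_dH (code_pow F (2 * p ^ s) i) 2,
        forall beta, 1 <= beta <= p - 2 ->
          beta * p ^ (s - 1) + 1 <= i <= (beta + 1) * p ^ (s - 1) ->
          is_dH (code_pow F (2 * p ^ s) i) (beta + 2)
      & forall tau k, 1 <= tau <= p - 1 -> 1 <= k <= s - 1 ->
          p ^ s - p ^ (s - k) + (tau - 1) * p ^ (s - k - 1) + 1 <= i
            <= p ^ s - p ^ (s - k) + tau * p ^ (s - k - 1) ->
          is_dH (code_pow F (2 * p ^ s) i) ((tau + 1) * p ^ k)]).
Proof.
move=> p_pr p3 m_odd s_gt0 cardF.
have p_gt1 := prime_gt1 p_pr.
have pcharFp := card_finPcharP cardF p_pr.
have ps_gt0 : 0 < 2 * p ^ s by rewrite muln_gt0 expn_gt0 (ltnW p_gt1).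
have hE := esym (X2add1_pchar p_pr pcharFp s).
have card4 : #|F| %% 4 = 3.
  rewrite cardF -modnXm p3 modnXm -[m]odd_double_half m_odd -mul2n expnD expnM.
  by rewrite -modnMmr -modnXm exp1n.
split=> [C|i le_i].
  split=> [|[i _ ->]]; last exact: code_pow_ideal.
  exact: negacyclic_code_pow hE _ (irreducible_X2add1 card4).
have dH := @is_dH_code_pow p s F p_pr pcharFp i.
have dH0 t : 0 < t < p -> (t - 1) * p ^ (s - 1) < i <= t * p ^ (s - 1) ->
    is_dH (code_pow F (2 * p ^ s) i) (t + 1).
  move=> t_bd /andP[lt_i le_it]; have := dH 0 t t_bd s_gt0.
  by rewrite subn0 subnn !add0n muln1; apply.
split=> [i_bd|beta beta_bd i_bd|tau k tau_bd k_bd i_bd].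
- by apply: (dH0 1) => //; rewrite mul0n mul1n.
- have -> : beta + 2 = (beta + 1) + 1 by lia.
  by apply: dH0; [lia | rewrite addnK; lia].
by apply: dH; lia.
Qed.
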